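(* Let $G$ be a graph such that $d_u+d_v\ge 6$ for every edge $uv$ of $G$. Then the iterated line graphs $\mathcal{L}^k(G)$ are hyperenergetic for every $k\ge 2$.
   Context: $d_u$ is the degree of $u$ in $G$; $\mathcal{L}^k$ is the $k$-th iterated line graph. The energy $\mathcal{E}(X)$ of a graph is the sum of absolute values of its adjacency eigenvalues. A graph $X$ of order $N$ is hyperenergetic if $\mathcal{E}(X)>\mathcal{E}(K_N)=2(N-1)$. *)

(* Defs.v *)
From HB Require Import structures.
From mathcomp Require Import all_boot all_order all_algebra all_field.

Set Implicit Arguments.
Unset Strict Implicit.
Unset Printing Implicit Defensive.

Import Order.TTheory GRing.Theory Num.Theory.
Local Open Scope ring_scope.

Record sgraph := SGraph {
  vertex :> finType;
  adj : rel vertex;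
  adj_sym : symmetric adj;
  adj_irrefl : irreflexive adj
}.

Definition degree (G : sgraph) (u : G) : nat := #|[set v : G | adj u v]|.

Definition edges (G : sgraph) : {set {set G}} :=
  [set [set p.1; p.2] | p in [set p : G * G | adj p.1 p.2]].

Definition line_adj (G : sgraph) : rel {e : {set G} | e \in edges G} :=
  fun e f => (e != f) && (val e :&: val f != set0).

Lemma line_adj_sym (G : sgraph) : symmetric (@line_adj G).
Proof. by move=> e f; rewrite /line_adj eq_sym setIC. Qed.

Lemma line_adj_irrefl (G : sgraph) : irreflexive (@line_adj G).
Proof. by move=> e; rewrite /line_adj eqxx. Qed.

Definition line_graph (G : sgraph) : sgraph :=
  SGraph (@line_adj_sym G) (@line_adj_irrefl G).

Definition iter_line_graph (k : nat) (G : sgraph) : sgraph :=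
  iter k line_graph G.

Definition adjmx (G : sgraph) : 'M[algC]_#|G| :=
  \matrix_(i, j) (adj (enum_val i) (enum_val j))%:R.

(* The eigenvalues with multiplicity: the roots of the characteristic
   polynomial, which splits over algC. *)
Definition spectrum (n : nat) (A : 'M[algC]_n) : seq algC :=
  sval (closed_field_poly_normal (char_poly A)).

Definition energy (G : sgraph) : algC := \sum_(z <- spectrum (adjmx G)) `|z|.

(* The bound 2(N - 1) is the energy of the complete graph on N >= 1 vertices,
   see energy_complete. The subtraction takes place in algC. *)
Definition hyperenergetic (G : sgraph) : Prop :=
  2 * (#|G|%:R - 1) < energy G.

Lemma neq_irrefl (T : eqType) : irreflexive (fun x y : T => x != y).
Proof. by move=> x; rewrite eqxx. Qed.

Lemma neq_sym (T : eqType) : symmetric (fun x y : T => x != y).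
Proof. by move=> x y; rewrite eq_sym. Qed.

Definition complete (n : nat) : sgraph :=
  SGraph (@neq_sym 'I_n) (@neq_irrefl 'I_n).

Lemma det_scalar_sub_const1 (R : idomainType) (m : nat) (a : R) : a != 0 ->
  \det (a%:M - const_mx 1 : 'M[R]_m) * a = (a - m%:R) * a ^+ m.
Proof.
move=> a0; pose u : 'cV[R]_m := const_mx 1; pose v : 'rV[R]_m := const_mx 1.
have uv : u *m v = const_mx 1.
  by apply/matrixP => i j; rewrite !mxE big_ord1 !mxE mulr1.
have vu : v *m u = (m%:R)%:M.
  apply/matrixP => i j; rewrite !ord1 !mxE eqxx.
  under eq_bigr => k _ do rewrite !mxE mulr1.
  by rewrite sumr_const card_ord.
pose M : 'M[R]_(1 + m) := block_mx 1%:M v u a%:M.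
have e1 : \det M = \det (a%:M - u *m v).
  have <- : \det (block_mx 1%:M 0 (- u) 1%:M *m M) = \det M.
    by rewrite det_mulmx det_lblock !det1 !mul1r.
  rewrite mulmx_block !mul1mx !mul0mx !addr0 mulmx1 addNr mulNmx.
  by rewrite det_ublock det1 mul1r addrC.
have e2 : \det M * a = (a - m%:R) * a ^+ m.
  have -> : \det M * a = \det (M *m block_mx a%:M 0 (- u) 1%:M).
    by rewrite det_mulmx det_lblock det1 mulr1 det_scalar1.
  rewrite mulmx_block !mulmx0 !mulmx1 !add0r mul1mx !mulmxN vu.
  rewrite mul_mx_scalar mul_scalar_mx subrr det_ublock det_scalar.
  by rewrite -raddfB /= det_scalar1.
by rewrite -uv -e1.
Qed.

Lemma energy_complete (n : nat) :
  (0 < n)%N -> energy (complete n) = 2 * (n%:R - 1).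
Proof.
case: n => // n _; rewrite /energy /spectrum.
set m := #|_|; have Em : m = n.+1 by rewrite /m /= card_ord.
case: closed_field_poly_normal => r /=.
rewrite (monicP (char_poly_monic _)) scale1r => Dr.
have X1 : 'X + 1 != 0 :> {poly algC}.
  by rewrite -[1]opprK -[-1]/(- 1%:P) -polyCN polyXsubC_eq0.
have Dc : char_poly (adjmx (complete n.+1)) = ('X - n%:R%:P) * ('X + 1) ^+ n.
  apply: (mulIf X1); rewrite /char_poly.
  have -> : char_poly_mx (adjmx (complete n.+1)) = ('X + 1)%:M - const_mx 1.
    apply/matrixP => i j; rewrite !mxE /= (inj_eq enum_val_inj).
    by case: eqVneq => _; rewrite ?polyC0 ?polyC1 ?mulr1n ?mulr0n ?subr0 ?addrK.
  rewrite det_scalar_sub_const1 // -/m Em -mulrA -exprSr; congr (_ * _).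
  by rewrite -natr1 opprD addrACA subrr addr0 polyC_natr.
have Pr : perm_eq r (n%:R :: nseq n (-1)).
  apply: prod_XsubC_eq; rewrite -Dr Dc big_cons; congr (_ * _).
  by rewrite big_nseq iter_mulr_1 polyCN opprK.
rewrite (perm_big _ Pr) big_cons big_nseq normrN1 normr_nat /=.
by rewrite iter_addr_0 -(natr1 n) addrK mulr_natl mulr2n.
Qed.

(* Main.v *)
Require Import Defs.
From mathcomp Require Import all_boot all_order all_algebra all_field.

(** The line graph of a graph with [n] vertices and [m] edges has adjacency
    matrix [B^T B - 2 I], where [B] is the [n x m] incidence matrix, so [-2] is
    an eigenvalue of multiplicity at least [m - n]. The trace vanishes, hence
    the remaining eigenvalues sum to [2 (m - n)], and the energy is at least
    [4 (m - n)], which exceeds [2 (m - 1)] as soon as [m >= 2 n]. The latter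
    holds when all degrees are at least 4. Since an edge [uv] has degree
    [d_u + d_v - 2] in the line graph, the hypothesis gives this for [L(G)], and
    it is inherited by all further line graphs. *)

Set Implicit Arguments.
Unset Strict Implicit.
Unset Printing Implicit Defensive.

Import Order.TTheory GRing.Theory Num.Theory.

Lemma edgesP (G : sgraph) (e : {set G}) :
  reflect (exists u v, adj u v /\ e = [set u; v]) (e \in edges G).
Proof.
apply: (iffP imsetP) => [[[u v]]|[u [v [uv ->]]]].
  by rewrite inE /= => uv ->; exists u, v.
by exists (u, v); rewrite ?inE.
Qed.

Lemma adj_neq (G : sgraph) (u v : G) : adj u v -> u != v.
Proof. by apply: contraTneq => ->; rewrite adj_irrefl. Qed.

Lemma card_edge (G : sgraph) (e : {set G}) : e \in edges G -> #|e| = 2.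
Proof. by case/edgesP => u [v [/adj_neq uv ->]]; rewrite cards2 uv. Qed.

(** If two 2-element sets share two elements, both equal their intersection. This identifies
    intersection sizes with the 0/1 adjacency of the line graph. *)
Lemma card_edgeI (G : sgraph) (e f : {set G}) :
    e \in edges G -> f \in edges G -> e != f ->
  #|e :&: f| = (e :&: f != set0).
Proof.
move=> /card_edge e2 /card_edge f2 ef; rewrite -card_gt0.
suff: #|e :&: f| < 2 by case: #|_| => [|[]].
rewrite ltnNge; apply: contra ef => ge2.
have /eqP <- : e :&: f == e by rewrite eqEcard subsetIl e2.
by rewrite eqEcard subsetIr f2.
Qed.

Lemma card_edges_at (G : sgraph) (u : G) :
  #|[set e in edges G | u \in e]| = degree u.
Proof.
rewrite /degree -(card_in_imset (f := fun v => [set u; v])) => [|v w].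
  congr #|pred_of_set _|; apply/setP => e; rewrite inE.
  apply/andP/imsetP => [[/edgesP [x [y [xy ->]]]]|[v]].
    rewrite !inE => /orP [] /eqP ->; first by exists y; rewrite ?inE.
    by exists x; rewrite ?inE 1?adj_sym // setUC.
  by rewrite inE => uv ->; rewrite !inE eqxx; split=> //; apply/edgesP; exists u, v.
rewrite !inE => uv _ E; have: v \in [set u; w] by rewrite -E !inE eqxx orbT.
by rewrite !inE eq_sym (negPf (adj_neq uv)) => /eqP.
Qed.

(** Double counting of incidences: with [A] the whole vertex set it yields the handshake lemma, with
    [A] an edge the degrees in the line graph. *)
Lemma sum_card_edgeI (G : sgraph) (A : {set G}) :
  \sum_(e in edges G) #|A :&: e| = \sum_(u in A) degree u.
Proof.
transitivity (\sum_(e in edges G) \sum_(u in A | u \in e) 1).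
  by apply: eq_bigr => e _; rewrite -sum1_card; apply: eq_bigl => u; rewrite inE.
rewrite (exchange_big_dep (mem A)) => [|e u _ /andP[] //].
apply: eq_bigr => u uA; rewrite -card_edges_at -sum1_card.
by apply: eq_bigl => e; rewrite inE; move: uA => /= ->.
Qed.

Lemma sum_degree (G : sgraph) : \sum_(u : G) degree u = 2 * #|edges G|.
Proof.
have <- : \sum_(u in [set: G]) degree u = \sum_(u : G) degree u.
  by apply: eq_bigl => u; rewrite inE.
rewrite -sum_card_edgeI mulnC -sum_nat_const.
by apply: eq_bigr => e eG; rewrite setTI card_edge.
Qed.

Lemma degree_line_graph (G : sgraph) (e : line_graph G) :
  degree e + 2 = \sum_(u in val e) degree u.
Proof.
(* The edge [e] meets itself in two vertices, which accounts for the 2; each other edge contributes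
   1 exactly when it is a neighbour of [e]. *)
rewrite -sum_card_edgeI (bigD1 (val e)) ?(valP e) //= setIid card_edge ?(valP e) //.
rewrite addnC (big_sub_cond _ (fun f => f != val e)) /=; congr (_ + _).
rewrite /degree -sum1dep_card.
rewrite [LHS]big_mkcond [RHS]big_mkcond; apply: eq_bigr => f _ /=.
rewrite /line_adj (inj_eq val_inj) [f == e]eq_sym.
by case: eqVneq => //= ef; rewrite card_edgeI ?(valP e) ?(valP f).
Qed.

Lemma card_line_graph (G : sgraph) : #|line_graph G| = #|edges G|.
Proof. exact: card_sig. Qed.

Local Open Scope ring_scope.

(* Both sides are the determinant of [block_mx 1 V U a%:M], times [a ^+ n]. *)
Lemma det_scalar_sub_mulmxC (R : comNzRingType) (m n : nat) (a : R)
    (U : 'M[R]_(m, n)) (V : 'M[R]_(n, m)) :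
  \det (a%:M - U *m V) * a ^+ n = \det (a%:M - V *m U) * a ^+ m.
Proof.
pose M : 'M[R]_(n + m) := block_mx 1%:M V U a%:M.
have <- : \det M = \det (a%:M - U *m V).
  have <- : \det (block_mx 1%:M 0 (- U) 1%:M *m M) = \det M.
    by rewrite det_mulmx det_lblock !det1 !mul1r.
  rewrite mulmx_block !mul1mx !mul0mx !addr0 mulmx1 addNr mulNmx.
  by rewrite det_ublock det1 mul1r addrC.
have -> : \det M * a ^+ n = \det (M *m block_mx a%:M 0 (- U) 1%:M).
  by rewrite det_mulmx det_lblock det1 mulr1 det_scalar.
rewrite mulmx_block !mulmx0 !mulmx1 !add0r mul1mx !mulmxN.
by rewrite mul_mx_scalar mul_scalar_mx subrr det_ublock det_scalar.
Qed.

(** The determinant identity over polynomials, with ['X - c%:P] as the scalar [a]. *)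
Lemma char_poly_mulmxC (R : comNzRingType) (m n : nat) (c : R)
    (U : 'M[R]_(m, n)) (V : 'M[R]_(n, m)) :
  char_poly (U *m V + c%:M) * ('X - c%:P) ^+ n =
  char_poly (V *m U + c%:M) * ('X - c%:P) ^+ m.
Proof.
have E p q (P : 'M[R]_(p, q)) (Q : 'M[R]_(q, p)) :
    char_poly_mx (P *m Q + c%:M) =
    ('X - c%:P)%:M - map_mx polyC P *m map_mx polyC Q.
  rewrite /char_poly_mx map_mxD map_mxM map_scalar_mx raddfB /= opprD.
  by rewrite addrCA addrC.
by rewrite /char_poly !E det_scalar_sub_mulmxC.
Qed.

Lemma char_poly_spectrum (n : nat) (A : 'M[algC]_n) :
  char_poly A = \prod_(z <- spectrum A) ('X - z%:P).
Proof.
rewrite /spectrum; case: closed_field_poly_normal => r /= {1}->.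
by rewrite (monicP (char_poly_monic A)) scale1r.
Qed.

Lemma size_spectrum (n : nat) (A : 'M[algC]_n) : size (spectrum A) = n.
Proof.
by have := size_char_poly A; rewrite char_poly_spectrum size_prod_XsubC => -[].
Qed.

(** Vieta: the subleading coefficient of [char_poly A] is minus the trace and minus the sum of the
    roots. It exists only in positive size, so the empty matrix is treated apart. *)
Lemma sum_spectrum (n : nat) (A : 'M[algC]_n) :
  \sum_(z <- spectrum A) z = \tr A.
Proof.
case: n A => [|n] A.
  have /size0nil -> := size_spectrum A.
  by rewrite big_nil /mxtrace big_ord0.
apply: oppr_inj; rewrite -char_poly_trace // char_poly_spectrum.
by rewrite -coefPn_prod_XsubC size_spectrum.
Qed.

Lemma spectrum_mulmx_add_scalar (m n : nat) (c : algC)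
    (U : 'M[algC]_(m, n)) (V : 'M[algC]_(n, m)) : (n <= m)%N ->
  perm_eq (spectrum (U *m V + c%:M))
          (nseq (m - n) c ++ spectrum (V *m U + c%:M)).
Proof.
move=> le_nm; apply: prod_XsubC_eq.
rewrite big_cat /= -!char_poly_spectrum big_nseq iter_mulr_1.
have nz : ('X - c%:P) ^+ n != 0 by rewrite expf_neq0 // polyXsubC_eq0.
by apply: (mulIf nz); rewrite char_poly_mulmxC mulrAC -exprD subnK // mulrC.
Qed.

Definition incmx (G : sgraph) : 'M[algC]_(#|G|, #|line_graph G|) :=
  \matrix_(i, j) (enum_val i \in val (enum_val j : line_graph G))%:R.

Lemma adjmx_line_graph (G : sgraph) :
  adjmx (line_graph G) = (incmx G)^T *m incmx G + (- 2)%:M.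
Proof.
apply/matrixP => i j; rewrite !mxE.
set e := enum_val i; set f := enum_val j.
have -> : \sum_k (incmx G)^T i k * incmx G k j = #|val e :&: val f|%:R.
  under eq_bigr => k _ do rewrite !mxE -natrM mulnb -in_setI.
  rewrite -natr_sum -sum1_card; congr _%:R.
  rewrite -(big_enum_val (fun u => nat_of_bool (u \in val e :&: val f))) /=.
  by rewrite [RHS]big_mkcond; apply: eq_bigr => u _; case: (u \in _).
(* On the diagonal the intersection size 2 cancels against -2. *)
rewrite -(inj_eq enum_val_inj) -/e -/f; case: eqVneq => [->|ef] /=.
  by rewrite line_adj_irrefl setIid card_edge ?(valP f) // mulr1n subrr.
by rewrite /line_adj ef mulr0n addr0 card_edgeI ?(valP e) ?(valP f).
Qed.

Lemma mxtrace_adjmx (G : sgraph) : \tr (adjmx G) = 0.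
Proof. by rewrite /mxtrace big1 // => i _; rewrite mxE adj_irrefl. Qed.

Lemma energy_line_graph_ge (G : sgraph) : (#|G| <= #|edges G|)%N ->
  4 * (#|edges G| - #|G|)%:R <= energy (line_graph G).
Proof.
rewrite -card_line_graph => le_nm; have := sum_spectrum (adjmx (line_graph G)).
rewrite mxtrace_adjmx /energy adjmx_line_graph.
have P := spectrum_mulmx_add_scalar (- 2) (incmx G)^T (incmx G) le_nm.
rewrite !(perm_big _ P) !big_cat /= !big_nseq !iter_addr_0 => /eqP.
rewrite addrC addr_eq0 mulNrn opprK => /eqP E.
(* By [E] the other eigenvalues sum to 2(m - n), so their absolute values sum to at least that; the
   m - n copies of -2 contribute as much again. *)
have := ler_norm_sum (spectrum (incmx G *m (incmx G)^T + (- 2)%:M)) id xpredT.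
rewrite E -[2 *+ _]mulrnA !normr_nat mulrnA normrN normr_nat => le_sum.
by rewrite mulr_natr -[4]/((2 + 2)%:R) natrD mulrnDl lerD2l.
Qed.

Lemma hyperenergetic_line_graph (G : sgraph) :
  (2 * #|G| <= #|edges G|)%N -> hyperenergetic (line_graph G).
Proof.
move=> le_nm; have le1 : (#|G| <= #|edges G|)%N.
  by apply: leq_trans le_nm; rewrite leq_pmull.
apply: lt_le_trans (energy_line_graph_ge le1); rewrite card_line_graph.
(* Halving and moving 1 across leaves m < 2(m - n) + 1 in the naturals, that is 2n + m <= 2m. *)
rewrite -[4]/((2 * 2)%:R) natrM -mulrA ltr_pM2l // ltrBlDr -natrM natr1 ltr_nat.
rewrite ltnS mulnBr leq_subRL ?leq_mul2l ?le1 //.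
by rewrite [leqRHS]mul2n -addnn leq_add2r.
Qed.

Local Close Scope ring_scope.

Lemma degree_line_graph_ge4 (G : sgraph) :
    (forall u v : G, adj u v -> 6 <= degree u + degree v) ->
  forall e : line_graph G, 4 <= degree e.
Proof.
move=> hdeg e; rewrite -(leq_add2r 2) degree_line_graph.
have /edgesP [u [v [uv ->]]] := valP e.
by rewrite big_setU1 ?inE ?adj_neq //= big_set1 hdeg.
Qed.

Lemma iter_line_graph_degree (G : sgraph) (k : nat) :
    (forall u v : G, adj u v -> 6 <= degree u + degree v) ->
  forall u v : iter_line_graph k G, adj u v -> 6 <= degree u + degree v.
Proof.
move=> hdeg; elim: k => [//|k IHk] u v _.
by apply: leq_trans (leq_add (degree_line_graph_ge4 IHk u) (degree_line_graph_ge4 IHk v)).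
Qed.

Theorem theorem4p20 (G : sgraph)
  (hdeg : forall u v : G, adj u v -> 6 <= degree u + degree v)
  (k : nat) (hk : 2 <= k) :
  hyperenergetic (iter_line_graph k G).
Proof.
case: k hk => [|[|k]] // _.
(* The graph in the goal is the line graph of [H], and [H] is itself a line graph, so its degrees
   are at least 4. *)
set H := iter_line_graph k.+1 G.
have H4 (u : H) : 4 <= degree u.
  exact: degree_line_graph_ge4 (iter_line_graph_degree (k := k) hdeg) u.
apply: (@hyperenergetic_line_graph H).
(* Doubling both sides turns the goal into 4n <= 2m, where 2m is the degree sum. *)
rewrite -(leq_pmul2l (isT : 0 < 2)) mulnA -sum_degree mulnC -sum_nat_const.
exact: leq_sum.
Qed.
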